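(* If $(A,W)$ is a $T_1$ Pratt comonoid with $W$ countably infinite, then there exist crosswords over $W$ with infinitely many distinct rows and infinitely many distinct columns.
   Context: A Pratt comonoid is a pair $(A,W)$ where $A$ is a set and $W$ is a set of subsets of $A$ such that (i) $\emptyset\in W$ and $A\in W$; (ii) whenever $C\subseteq A\times A$ is such that for every $a\in A$ both the $a$-th row $\{b\mid (a,b)\in C\}$ and the $a$-th column $\{b\mid (b,a)\in C\}$ belong to $W$ (such $C$ is called a crossword over $W$), the diagonal $\{b\mid (b,b)\in C\}$ also belongs to $W$. $(A,W)$ is $T_1$ if for all distinct $a,b\in A$ some member of $W$ contains $a$ but not $b$. *)

(* Defs.v *)
(* Subsets of A are predicates A -> Prop; set equality is
   Leibniz equality of predicates (which, with the whitelisted functional and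
   propositional extensionality axioms, coincides with extensional equality). *)

Definition row {A : Type} (C : A -> A -> Prop) (a : A) : A -> Prop :=
  fun b => C a b.
Definition column {A : Type} (C : A -> A -> Prop) (a : A) : A -> Prop :=
  fun b => C b a.
Definition diagonal {A : Type} (C : A -> A -> Prop) : A -> Prop :=
  fun b => C b b.

Definition crossword {A : Type} (W : (A -> Prop) -> Prop) (C : A -> A -> Prop) : Prop :=
  forall a : A, W (row C a) /\ W (column C a).

Definition pratt_comonoid {A : Type} (W : (A -> Prop) -> Prop) : Prop :=
  W (fun _ => False) /\ W (fun _ => True) /\
  (forall C : A -> A -> Prop, crossword W C -> W (diagonal C)).

Definition T1 {A : Type} (W : (A -> Prop) -> Prop) : Prop :=
  forall a b : A, a <> b -> exists S, W S /\ S a /\ ~ S b.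

Definition countably_infinite {X : Type} (W : X -> Prop) : Prop :=
  exists e : nat -> X,
    (forall m n, e m = e n -> m = n) /\
    (forall S, W S <-> exists n, e n = S).

Definition infinitely_many_distinct {A Y : Type} (f : A -> Y) : Prop :=
  exists g : nat -> A, forall m n, m <> n -> f (g m) <> f (g n).

(* Main.v *)
Require Import Defs.
From Stdlib Require Import Classical ClassicalEpsilon FunctionalExtensionality PropExtensionality.
From Stdlib Require Import List Arith Lia Wf_nat.
Import ListNotations.

(* Taking diagonals of suitable crosswords shows that W is closed under finite unions and
   intersections and under arbitrary unions of disjoint families.  Since W is countable, a
   Cantor diagonal argument (A is infinite because W is) shows that W misses some singleton
   {a} and some cosingleton A \ {b}.  Unions of the first n members of W avoiding b form an
   increasing chain K_n in W that never stabilises, as its union A \ {b} is not in W;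
   intersections of the first n members containing a form a decreasing chain with meet {a},
   and cutting it with a member of W that misses a but meets every link (which exists, by a
   second Cantor argument) gives a decreasing chain D_n in W of nonempty sets with empty
   meet.  The union of the rectangles D_n x K_n is then a crossword: its rows are among the
   K_n and its columns among the D_n, and both run through infinitely many of them. *)

Lemma set_ext {A : Type} (U V : A -> Prop) : (forall x, U x <-> V x) -> U = V.
Proof.
  intro H; apply functional_extensionality; intro x; apply propositional_extensionality, H.
Qed.

Lemma W_iff {A : Type} (W : (A -> Prop) -> Prop) (U V : A -> Prop) :
  W U -> (forall x, U x <-> V x) -> W V.
Proof. intros HU H; rewrite <- (set_ext U V H); exact HU. Qed.

Lemma least_nat (P : nat -> Prop) :
  (exists n, P n) -> exists n, P n /\ forall m, P m -> n <= m.
Proof.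
  intro H.
  destruct (dec_inh_nat_subset_has_unique_least_element P (fun n => classic (P n)) H)
    as [n [Hn _]].
  exists n; exact Hn.
Qed.

Lemma iter_le_of_inflationary (f : nat -> nat) (x0 : nat) :
  (forall n, n <= f n) -> forall j k, j <= k -> Nat.iter j f x0 <= Nat.iter k f x0.
Proof.
  intros Hf j k Hjk; induction Hjk as [|k _ IH]; [lia|].
  simpl; specialize (Hf (Nat.iter k f x0)); lia.
Qed.

Definition strict_subset {A : Type} (U V : A -> Prop) : Prop :=
  (forall x, U x -> V x) /\ exists x, V x /\ ~ U x.

Lemma strict_subset_irrefl {A : Type} (U : A -> Prop) : ~ strict_subset U U.
Proof. intros [_ [x [Hx Hnx]]]; exact (Hnx Hx). Qed.

Lemma strict_subset_trans {A : Type} (U V Z : A -> Prop) :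
  strict_subset U V -> strict_subset V Z -> strict_subset U Z.
Proof.
  intros [HUV [x [HVx HUx]]] [HVZ _].
  split; [auto | exists x; split; auto].
Qed.

Lemma infinitely_many_distinct_of_unbounded {X Y : Type} (f : X -> Y) (lt : Y -> Y -> Prop) :
  (forall y, ~ lt y y) -> (forall y1 y2 y3, lt y1 y2 -> lt y2 y3 -> lt y1 y3) ->
  inhabited X -> (forall x, exists x', lt (f x) (f x')) -> infinitely_many_distinct f.
Proof.
  intros Hirr Htrans [x0] Hnext.
  destruct (choice _ Hnext) as [next Hnext'].
  set (g := fun n => Nat.iter n next x0).
  assert (Hmono : forall m n, m < n -> lt (f (g m)) (f (g n))).
  { intros m n Hmn; induction Hmn as [|n _ IH]; [apply Hnext'|].
    exact (Htrans _ _ _ IH (Hnext' (g n))). }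
  exists g; intros m n Hmn Heq.
  destruct (Nat.lt_total m n) as [Hlt | [Heqmn | Hlt]]; [| contradiction |].
  - apply (Hirr (f (g n))); rewrite <- Heq at 1; exact (Hmono m n Hlt).
  - apply (Hirr (f (g m))); rewrite Heq at 1; exact (Hmono n m Hlt).
Qed.

Lemma infinitely_many_distinct_comp {X A Y : Type} (f : A -> Y) (h : X -> A) :
  infinitely_many_distinct (fun x => f (h x)) -> infinitely_many_distinct f.
Proof. intros [g Hg]; exists (fun n => h (g n)); exact Hg. Qed.

Lemma list_agreement_pigeonhole {A : Type} (L : list A) (f : nat -> A -> Prop) :
  forall I : nat -> Prop, (forall N, exists n, N <= n /\ I n) ->
  exists m n, m <> n /\ I m /\ I n /\ forall x, In x L -> (f m x <-> f n x).
Proof.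
  induction L as [|a L IH]; intros I HI.
  - destruct (HI 0) as [m [_ Hm]]; destruct (HI (S m)) as [n [Hmn Hn]].
    exists m, n; split; [lia|]; split; [exact Hm|]; split; [exact Hn | intros x []].
  - destruct (classic (forall N, exists n, N <= n /\ I n /\ f n a)) as [Hin | Hout].
    + destruct (IH (fun n => I n /\ f n a)) as (m & n & Hmn & [Hm Hma] & [Hn Hna] & Hagree).
      { intro N; destruct (Hin N) as [n Hn]; exists n; tauto. }
      exists m, n; split; [exact Hmn|]; split; [exact Hm|]; split; [exact Hn|].
      intros x [<- | HxL]; [tauto | apply Hagree, HxL].
    + apply not_all_ex_not in Hout as [N0 HN0].
      destruct (IH (fun n => I n /\ ~ f n a)) as (m & n & Hmn & [Hm Hma] & [Hn Hna] & Hagree).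
      { intro N; destruct (HI (max N N0)) as [n [Hn HIn]]; exists n; split; [lia|].
        split; [exact HIn|]; intro Hna; apply HN0; exists n; split; [lia | auto]. }
      exists m, n; split; [exact Hmn|]; split; [exact Hm|]; split; [exact Hn|].
      intros x [<- | HxL]; [tauto | apply Hagree, HxL].
Qed.

Lemma exists_not_in_list {A : Type} (f : nat -> A -> Prop) :
  (forall m n, f m = f n -> m = n) -> forall L : list A, exists x, ~ In x L.
Proof.
  intros Hinj L; apply NNPP; intro Hcover.
  destruct (list_agreement_pigeonhole L f (fun _ => True)) as (m & n & Hmn & _ & _ & Hagree).
  { intro N; exists N; auto. }
  apply Hmn, Hinj, set_ext; intro x; apply Hagree.
  apply NNPP; intro HxL; apply Hcover; exists x; exact HxL.
Qed.

Fixpoint fresh_prefix {A : Type} (fresh : list A -> A) (n : nat) : list A :=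
  match n with
  | 0 => []
  | S n => fresh (fresh_prefix fresh n) :: fresh_prefix fresh n
  end.

Lemma in_fresh_prefix {A : Type} (fresh : list A -> A) (m n : nat) :
  m < n -> In (fresh (fresh_prefix fresh m)) (fresh_prefix fresh n).
Proof. intro Hmn; induction Hmn; simpl; auto. Qed.

Lemma injective_seq_of_injective_subsets {A : Type} (f : nat -> A -> Prop) :
  (forall m n, f m = f n -> m = n) -> exists p : nat -> A, forall m n, p m = p n -> m = n.
Proof.
  intro Hinj.
  destruct (choice _ (exists_not_in_list f Hinj)) as [fresh Hfresh].
  exists (fun n => fresh (fresh_prefix fresh n)); intros m n Heq.
  destruct (Nat.lt_total m n) as [Hlt | [Heqmn | Hlt]]; auto; exfalso.
  - apply (Hfresh (fresh_prefix fresh n)); rewrite <- Heq; apply in_fresh_prefix, Hlt.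
  - apply (Hfresh (fresh_prefix fresh m)); rewrite Heq; apply in_fresh_prefix, Hlt.
Qed.

Definition increasing {A : Type} (K : nat -> A -> Prop) : Prop :=
  forall m n x, m <= n -> K m x -> K n x.

Definition decreasing {A : Type} (D : nat -> A -> Prop) : Prop :=
  forall m n x, m <= n -> D n x -> D m x.

(** * Closure properties of Pratt comonoids *)

Section PrattComonoid.

Variables (A : Type) (W : (A -> Prop) -> Prop).
Hypothesis HW : pratt_comonoid W.

Lemma W_empty : W (fun _ => False).
Proof. destruct HW as [H0 _]; exact H0. Qed.

Lemma W_full : W (fun _ => True).
Proof. destruct HW as [_ [H1 _]]; exact H1. Qed.

Lemma W_of_diagonal (C : A -> A -> Prop) (S : A -> Prop) :
  crossword W C -> (forall x, C x x <-> S x) -> W S.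
Proof.
  intros HC HS; destruct HW as [_ [_ Hdiag]].
  apply (W_iff W (diagonal C)); [apply Hdiag, HC | exact HS].
Qed.

Lemma W_and_l (P : Prop) (U : A -> Prop) : W U -> W (fun x => P /\ U x).
Proof.
  intro HU; destruct (classic P).
  - apply (W_iff W U); [exact HU | tauto].
  - apply (W_iff W _ _ W_empty); tauto.
Qed.

Lemma W_or_l (P : Prop) (U : A -> Prop) : W U -> W (fun x => P \/ U x).
Proof.
  intro HU; destruct (classic P).
  - apply (W_iff W _ _ W_full); tauto.
  - apply (W_iff W U); [exact HU | tauto].
Qed.

Lemma W_imply_l (P : Prop) (U : A -> Prop) : W U -> W (fun x => P -> U x).
Proof.
  intro HU; destruct (classic P).
  - apply (W_iff W U); [exact HU | tauto].
  - apply (W_iff W _ _ W_full); tauto.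
Qed.

Lemma W_inter (U V : A -> Prop) : W U -> W V -> W (fun x => U x /\ V x).
Proof.
  intros HU HV; apply (W_of_diagonal (fun x y => U x /\ V y)); [|tauto].
  intro a; split; [apply W_and_l, HV|].
  apply (W_iff W _ _ (W_and_l (V a) U HU)); unfold column; tauto.
Qed.

Lemma W_union (U V : A -> Prop) : W U -> W V -> W (fun x => U x \/ V x).
Proof.
  intros HU HV; apply (W_of_diagonal (fun x y => U x \/ V y)); [|tauto].
  intro a; split; [apply W_or_l, HV|].
  apply (W_iff W _ _ (W_or_l (V a) U HU)); unfold column; tauto.
Qed.

Lemma W_bigcup_le (F : nat -> A -> Prop) :
  (forall i, W (F i)) -> forall n, W (fun x => exists i, i <= n /\ F i x).
Proof.
  intros HF n; induction n as [|n IH].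
  - apply (W_iff W (F 0)); [apply HF|].
    intro x; split; [exists 0; auto | intros [i [Hi Hx]]; replace i with 0 in Hx by lia; auto].
  - apply (W_iff W _ _ (W_union _ _ IH (HF (S n)))).
    intro x; split.
    + intros [[i [Hi Hx]] | Hx]; [exists i; split; [lia | auto] | exists (S n); auto].
    + intros [i [Hi Hx]]; destruct (Nat.eq_dec i (S n)) as [-> | Hne]; [right; auto|].
      left; exists i; split; [lia | auto].
Qed.

Lemma W_bigcap_le (F : nat -> A -> Prop) :
  (forall i, W (F i)) -> forall n, W (fun x => forall i, i <= n -> F i x).
Proof.
  intros HF n; induction n as [|n IH].
  - apply (W_iff W (F 0)); [apply HF|].
    intro x; split; [intros Hx i Hi; replace i with 0 by lia; auto | intro Hx; apply Hx; auto].
  - apply (W_iff W _ _ (W_inter _ _ IH (HF (S n)))).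
    intro x; split.
    + intros [Hx HSx] i Hi; destruct (Nat.eq_dec i (S n)) as [-> | Hne]; auto.
      apply Hx; lia.
    + intro Hx; split; [intros i Hi; apply Hx; lia | apply Hx; auto].
Qed.

Lemma W_of_singletons : (forall a, W (fun x => x = a)) -> forall S, W S.
Proof.
  intros Hsing S; apply (W_of_diagonal (fun x y => x = y /\ S x)).
  - intro a; split.
    + apply (W_iff W _ _ (W_and_l (S a) _ (Hsing a))); unfold row; intro y.
      split; intros [H1 H2]; auto.
    + apply (W_iff W _ _ (W_and_l (S a) _ (Hsing a))); unfold column; intro y.
      split; [intros [HSa ->] | intros [-> HSa]]; auto.
  - intro x; tauto.
Qed.

Lemma W_of_cosingletons : (forall b, W (fun x => x <> b)) -> forall S, W S.
Proof.
  intros Hcosing S; apply (W_of_diagonal (fun x y => x <> y \/ S x)).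
  - intro a; split.
    + apply (W_iff W _ _ (W_or_l (S a) _ (Hcosing a))); unfold row; intro y.
      split; intros [H | H]; auto.
    + apply (W_iff W _ _ (W_or_l (S a) _ (Hcosing a))); unfold column; intro y.
      destruct (classic (y = a)) as [-> | Hya]; tauto.
  - intro x; split; [intros [H | H]; [contradiction | auto] | auto].
Qed.

Lemma W_disjoint_union (P : nat -> A -> Prop) :
  (forall k, W (P k)) -> (forall j k x, P j x -> P k x -> j = k) ->
  forall J : nat -> Prop, W (fun x => exists k, J k /\ P k x).
Proof.
  intros HP Hdisj J.
  assert (Hrow : forall a, W (fun y => exists k, J k /\ P k a /\ P k y)).
  { intro a; destruct (classic (exists j, J j /\ P j a)) as [[j [Jj Pja]] | Hnone].
    - apply (W_iff W (P j)); [apply HP|]; intro y; split.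
      + intro Pjy; exists j; auto.
      + intros [k [_ [Pka Pky]]]; rewrite (Hdisj j k a Pja Pka); exact Pky.
    - apply (W_iff W _ _ W_empty); intro y; split; [tauto|].
      intros [k [Jk [Pka _]]]; apply Hnone; exists k; auto. }
  apply (W_of_diagonal (fun x y => exists k, J k /\ P k x /\ P k y)).
  - intro a; split; [apply Hrow|].
    apply (W_iff W _ _ (Hrow a)); unfold column; intro y.
    split; intros [k Hk]; exists k; tauto.
  - intro x; split; intros [k Hk]; exists k; tauto.
Qed.

(** * Cantor's diagonal argument *)

Hypothesis HC : countably_infinite W.

(* Every union of a subfamily would lie in W; diagonalise against the enumeration of W. *)
Lemma no_disjoint_family (P : nat -> A -> Prop) :
  (forall k, W (P k)) -> (forall j k x, P j x -> P k x -> j = k) ->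
  ~ forall k, exists x, P k x.
Proof.
  intros HP Hdisj Hne.
  destruct (choice _ Hne) as [q Hq].
  destruct HC as [e [_ He]].
  set (J := fun k => ~ e k (q k)).
  destruct (proj1 (He _) (W_disjoint_union P HP Hdisj J)) as [m Hm].
  assert (Hdiag : e m (q m) <-> J m).
  { rewrite Hm; split; [intros [k [Jk Pk]]; rewrite (Hdisj _ _ _ Pk (Hq m)) in Jk; exact Jk |].
    intro Jm; exists m; auto. }
  unfold J in Hdiag; tauto.
Qed.

Lemma exists_not_in_W : exists S, ~ W S.
Proof.
  destruct HC as [e [Hinj _]].
  destruct (injective_seq_of_injective_subsets e Hinj) as [p Hp].
  apply not_all_ex_not; intro Hall.
  apply (no_disjoint_family (fun k x => x = p k)); [auto | | intro k; exists (p k); auto].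
  intros j k x -> Hx; apply Hp; exact Hx.
Qed.

Lemma exists_singleton_not_in_W : exists a, ~ W (fun x => x = a).
Proof.
  destruct exists_not_in_W as [S HS].
  apply not_all_ex_not; intro Hall; apply HS, W_of_singletons; exact Hall.
Qed.

Lemma exists_cosingleton_not_in_W : exists b, ~ W (fun x => x <> b).
Proof.
  destruct exists_not_in_W as [S HS].
  apply not_all_ex_not; intro Hall; apply HS, W_of_cosingletons; exact Hall.
Qed.

(** * Chains in a T1 Pratt comonoid *)

Hypothesis HT : T1 W.

Lemma T1_enumeration :
  exists e : nat -> A -> Prop, (forall n, W (e n)) /\
    forall x y, x <> y -> exists i, e i x /\ ~ e i y.
Proof.
  destruct HC as [e [_ He]].
  exists e; split; [intro n; apply He; exists n; reflexivity|].
  intros x y Hxy; destruct (HT x y Hxy) as [S [WS [Sx Sy]]].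
  destruct (proj1 (He S) WS) as [i <-]; exists i; auto.
Qed.

(* The chain exhausts A \ {b}, so it cannot stabilise at a member of W. *)
Lemma increasing_chain_not_stabilising (b : A) :
  ~ W (fun x => x <> b) ->
  exists K, (forall n, W (K n)) /\ increasing K /\
    forall N, exists z, ~ K N z /\ exists M, K M z.
Proof.
  intro Hb; destruct T1_enumeration as [e [We Te]].
  assert (WK : forall n, W (fun x => exists i, i <= n /\ (~ e i b /\ e i x))).
  { apply W_bigcup_le; intro i; apply W_and_l, We. }
  exists (fun n x => exists i, i <= n /\ (~ e i b /\ e i x)); split; [exact WK|]; split.
  - intros m n x Hmn [i [Hi Hx]]; exists i; split; [lia | exact Hx].
  - intro N; apply NNPP; intro Hstable; apply Hb, (W_iff W _ _ (WK N)); intro x; split.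
    + intros [i [_ [Hib Hix]]] ->; contradiction.
    + intro Hxb; destruct (Te x b Hxb) as [i [Hix Hib]].
      apply NNPP; intro HNx; apply Hstable; exists x; split; [exact HNx | exists i, i; auto].
Qed.

(* The chain has meet {a}, so none of its members is {a}. *)
Lemma decreasing_chain_to_point (a : A) :
  ~ W (fun x => x = a) ->
  exists V, (forall n, W (V n)) /\ decreasing V /\
    (forall x, x <> a -> exists n, ~ V n x) /\ forall N, exists x, V N x /\ x <> a.
Proof.
  intro Ha; destruct T1_enumeration as [e [We Te]].
  assert (WV : forall n, W (fun x => forall i, i <= n -> e i a -> e i x)).
  { apply W_bigcap_le; intro i; apply W_imply_l, We. }
  exists (fun n x => forall i, i <= n -> e i a -> e i x); split; [exact WV|]; split; [|split].
  - intros m n x Hmn Hx i Hi; apply Hx; lia.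
  - intros x Hxa; destruct (Te a x (not_eq_sym Hxa)) as [i [Hia Hix]].
    exists i; intro Hx; apply Hix, Hx; auto.
  - intro N; apply NNPP; intro Hnone; apply Ha, (W_iff W _ _ (WV N)); intro x; split.
    + intro Hx; apply NNPP; intro Hxa; apply Hnone; exists x; auto.
    + intros -> i _ Hi; exact Hi.
Qed.

(* Otherwise the sets R_N /\ V_N, along a fast enough subsequence of N, would be pairwise
   disjoint, contradicting [no_disjoint_family]. *)
Lemma separating_set_meets_chain (a : A) (V : nat -> A -> Prop) :
  (forall n, W (V n)) -> decreasing V -> (forall N, exists x, V N x /\ x <> a) ->
  exists R, W R /\ ~ R a /\ forall N, exists x, R x /\ V N x.
Proof.
  intros WV decV HneV; apply NNPP; intro Hnone.
  assert (Havoid : forall R, W R -> ~ R a -> exists M, forall y, R y -> ~ V M y).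
  { intros R WR Ra; apply NNPP; intro Hmeets; apply Hnone; exists R; split; [exact WR|].
    split; [exact Ra|]; intro M; apply NNPP; intro Hno; apply Hmeets; exists M.
    intros y Ry Vy; apply Hno; exists y; auto. }
  assert (HR : forall N, exists R, (W R /\ ~ R a) /\ exists x, R x /\ V N x).
  { intro N; destruct (HneV N) as [x [Vx Hxa]]; destruct (HT x a Hxa) as [R [WR [Rx Ra]]].
    exists R; split; [auto | exists x; auto]. }
  destruct (choice _ HR) as [R HR'].
  assert (HM : forall N, exists M, N <= M /\ forall y, R N y -> ~ V M y).
  { intro N; destruct (HR' N) as [[WR Ra] _]; destruct (Havoid _ WR Ra) as [M HM].
    exists (max N M); split; [lia|]; intros y Ry Vy.
    apply (HM y Ry), (decV M (max N M)); [lia | exact Vy]. }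
  destruct (choice _ HM) as [M HM'].
  set (n := fun k => Nat.iter k M 0).
  assert (Hsep : forall j k x, j < k -> R (n j) x -> V (n k) x -> False).
  { intros j k x Hjk Rx Vx; apply (proj2 (HM' (n j)) x Rx), (decV _ (n k)); [|exact Vx].
    exact (iter_le_of_inflationary M 0 (fun N => proj1 (HM' N)) (S j) k Hjk). }
  apply (no_disjoint_family (fun k x => R (n k) x /\ V (n k) x)).
  - intro k; apply W_inter; [apply HR' | apply WV].
  - intros j k x [Rj Vj] [Rk Vk].
    destruct (Nat.lt_total j k) as [Hlt | [Heq | Hlt]];
      [exfalso; eauto | exact Heq | exfalso; eauto].
  - intro k; apply HR'.
Qed.

Lemma decreasing_chain_empty_meet (a : A) :
  ~ W (fun x => x = a) ->
  exists D, (forall n, W (D n)) /\ decreasing D /\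
    (forall N, exists x, D N x) /\ forall x, exists N, ~ D N x.
Proof.
  intro Ha; destruct (decreasing_chain_to_point a Ha) as (V & WV & decV & meetV & HneV).
  destruct (separating_set_meets_chain a V WV decV HneV) as (R & WR & Ra & HR).
  exists (fun n x => R x /\ V n x); split; [|split; [|split]].
  - intro n; apply W_inter; auto.
  - intros m n x Hmn [Rx Vx]; split; [exact Rx | exact (decV m n x Hmn Vx)].
  - exact HR.
  - intro x; destruct (classic (x = a)) as [-> | Hxa]; [exists 0; tauto|].
    destruct (meetV x Hxa) as [N HN]; exists N; tauto.
Qed.

(** * The crossword of two chains *)

Section ChainCrossword.

Variables (D K : nat -> A -> Prop).
Hypotheses (WD : forall n, W (D n)) (WK : forall n, W (K n)).
Hypotheses (decD : decreasing D) (incK : increasing K).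
Hypotheses (neD : forall N, exists x, D N x) (meetD : forall x, exists N, ~ D N x).
Hypothesis growK : forall N, exists z, ~ K N z /\ exists M, K M z.

Definition chain_crossword (x y : A) : Prop := exists k, D k x /\ K k y.

Lemma row_chain_crossword_sub (x : A) (N : nat) :
  (forall n, D n x -> n <= N) -> forall y, row chain_crossword x y -> K N y.
Proof. intros HN y [k [Dk Kk]]; exact (incK k N y (HN k Dk) Kk). Qed.

Lemma row_chain_crossword_sup (x : A) (N : nat) :
  D N x -> forall y, K N y -> row chain_crossword x y.
Proof. intros DN y KN; exists N; auto. Qed.

Lemma column_chain_crossword_sub (y : A) (N : nat) :
  (forall n, K n y -> N <= n) -> forall x, column chain_crossword y x -> D N x.
Proof. intros HN x [k [Dk Kk]]; exact (decD N k x (HN k Kk) Dk). Qed.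

Lemma column_chain_crossword_sup (y : A) (N : nat) :
  K N y -> forall x, D N x -> column chain_crossword y x.
Proof. intros KN x DN; exists N; auto. Qed.

Lemma crossword_chain_crossword : crossword W chain_crossword.
Proof.
  intro x; split.
  - destruct (least_nat (fun n => ~ D n x) (meetD x)) as [[|k] [HN Hmin]].
    + apply (W_iff W _ _ W_empty); intro y; split; [tauto|].
      intros [n [Dn _]]; apply HN, (decD 0 n); [lia | exact Dn].
    + assert (Hlast : forall n, D n x -> n <= k).
      { intros n Dn; apply NNPP; intro Hn; apply HN, (decD (S k) n); [lia | exact Dn]. }
      apply (W_iff W (K k) _ (WK k)); intro y; split.
      * apply row_chain_crossword_sup; apply NNPP; intro Hk; specialize (Hmin k Hk); lia.
      * apply row_chain_crossword_sub, Hlast.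
  - destruct (classic (exists n, K n x)) as [HK | HnK].
    + destruct (least_nat _ HK) as [k [Kk Hmin]].
      apply (W_iff W (D k) _ (WD k)); intro y; split.
      * apply column_chain_crossword_sup, Kk.
      * apply column_chain_crossword_sub, Hmin.
    + apply (W_iff W _ _ W_empty); intro y; split; [tauto|].
      intros [n [_ Kn]]; apply HnK; exists n; exact Kn.
Qed.

Lemma infinitely_many_distinct_rows_chain_crossword :
  infinitely_many_distinct (row chain_crossword).
Proof.
  apply (infinitely_many_distinct_of_unbounded _ strict_subset
           strict_subset_irrefl strict_subset_trans).
  - destruct (neD 0) as [x _]; exact (inhabits x).
  - intro x; destruct (meetD x) as [N HN].
    destruct (growK N) as [z [HzN [M HzM]]]; destruct (neD (max N M)) as [x' Hx'].
    assert (Hsub : forall y, row chain_crossword x y -> K N y).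
    { apply row_chain_crossword_sub; intros n Dn.
      apply NNPP; intro Hn; apply HN, (decD N n); [lia | exact Dn]. }
    exists x'; split.
    + intros y Hy; apply (row_chain_crossword_sup x' _ Hx'), (incK N); [lia | apply Hsub, Hy].
    + exists z; split; [|intro Hz; apply HzN, Hsub, Hz].
      apply (row_chain_crossword_sup x' _ Hx'), (incK M); [lia | exact HzM].
Qed.

Lemma infinitely_many_distinct_columns_chain_crossword :
  infinitely_many_distinct (column chain_crossword).
Proof.
  apply (infinitely_many_distinct_comp _ (@proj1_sig A (fun y => exists M, K M y))).
  apply (infinitely_many_distinct_of_unbounded _ (fun U V => strict_subset V U)).
  - intro U; apply strict_subset_irrefl.
  - intros U V Z HUV HVZ; exact (strict_subset_trans _ _ _ HVZ HUV).
  - destruct (growK 0) as [z [_ Hz]]; exact (inhabits (exist _ z Hz)).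
  - intros [y [M HyM]]; destruct (neD M) as [x Hx]; destruct (meetD x) as [N HN].
    destruct (growK (max N M)) as [y' [Hy'N Hy']]; exists (exist _ y' Hy'); simpl.
    assert (Hsub : forall x0, column chain_crossword y' x0 -> D (max N M) x0).
    { apply column_chain_crossword_sub; intros n Kn.
      apply NNPP; intro Hn; apply Hy'N, (incK n); [lia | exact Kn]. }
    split.
    + intros x0 Hx0; apply (column_chain_crossword_sup y M HyM), (decD M (max N M));
        [lia | apply Hsub, Hx0].
    + exists x; split; [exact (column_chain_crossword_sup y M HyM x Hx)|].
      intro Hx'; apply HN, (decD N (max N M)); [lia | apply Hsub, Hx'].
Qed.

End ChainCrossword.

End PrattComonoid.

Theorem proposition8p6 (A : Type) (W : (A -> Prop) -> Prop) :
  pratt_comonoid W -> T1 W -> countably_infinite W ->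
  exists C : A -> A -> Prop,
    crossword W C /\
    infinitely_many_distinct (row C) /\
    infinitely_many_distinct (column C).
Proof.
  intros HW HT HC.
  destruct (exists_singleton_not_in_W A W HW HC) as [a Ha].
  destruct (exists_cosingleton_not_in_W A W HW HC) as [b Hb].
  destruct (decreasing_chain_empty_meet A W HW HC HT a Ha)
    as (D & WD & decD & neD & meetD).
  destruct (increasing_chain_not_stabilising A W HW HC HT b Hb) as (K & WK & incK & growK).
  exists (chain_crossword A D K); split; [|split].
  - apply crossword_chain_crossword; assumption.
  - apply infinitely_many_distinct_rows_chain_crossword; assumption.
  - apply infinitely_many_distinct_columns_chain_crossword; assumption.
Qed.
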